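(* Let $k$ be a field, $n \ge 4$, let $G$ be a simple graph on the vertex set $\{1,\dots,n\}$, and let $m \ge 3$ be an integer. Then $I_G^{(m)} = I_G^m$ if and only if $n = 4$ and $G$ is a path or a cycle or the union of two disjoint edges.
   Context: Let $S = k[x_1,\dots,x_n]$ be a polynomial ring. A simple graph here means a finite undirected graph without multiple edges, without loops and without isolated vertices (every vertex in $\{1,\dots,n\}$ belongs to an edge); so a path or a cycle on the vertex set $\{1,\dots,n\}$ passes through all $n$ vertices. We write $\{i,j\}\in G$ if $\{i,j\}$ is an edge of $G$. For $i \ne j$ put $P_{ij} = (x_t \mid t \ne i,j)$, the prime ideal of $S$ generated by all variables other than $x_i,x_j$. Define $I_G = \bigcap_{\{i,j\}\in G} P_{ij}$ and its $m$-th symbolic power $I_G^{(m)} = \bigcap_{\{i,j\}\in G} P_{ij}^m$; $I_G^m$ denotes the ordinary $m$-th power. *)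

(* Defs.v *)
From HB Require Import structures.
From mathcomp Require Import all_boot all_order all_algebra all_fingroup.
From mathcomp Require Export mpoly.

Set Implicit Arguments.
Unset Strict Implicit.
Unset Printing Implicit Defensive.

Import GRing.Theory.
Local Open Scope ring_scope.

(* Ideals are represented by their membership predicates [R -> Prop], since
   the ideals of [ring_quotient] are decidable and proper. *)
Section Ideals.
Variable R : comNzRingType.
Implicit Types I J : R -> Prop.

Definition ideal_eq I J := forall p, I p <-> J p.

Definition ideal_span (A : R -> Prop) : R -> Prop := fun p =>
  exists s : seq (R * R),
    (forall c, c \in s -> A c.2) /\ p = \sum_(c <- s) c.1 * c.2.

(* I^m is generated by the m-fold products of elements of I; I^0 = R. *)
Definition ideal_pow I (m : nat) : R -> Prop :=
  ideal_span (fun p =>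
    exists f : 'I_m -> R, (forall i, I (f i)) /\ p = \prod_(i < m) f i).

End Ideals.

(* A graph on the vertex set 'I_n is given by its set of edges, and an edge by
   its set of endpoints. The last clause excludes isolated vertices. *)
Definition simple_graph (n : nat) (G : {set {set 'I_n}}) : Prop :=
  (forall A : {set 'I_n}, A \in G -> #|A| = 2%N) /\ cover G = [set: 'I_n].

(* Spanning paths and cycles: s lists the vertices in order. *)
Definition is_path_graph (n : nat) (G : {set {set 'I_n}}) : Prop :=
  exists s : 'S_n,
    G = [set [set s i; s j] | i in 'I_n, j in 'I_n & j == i.+1 :> nat].

(* [ordS] is the successor modulo n. *)
Definition is_cycle_graph (n : nat) (G : {set {set 'I_n}}) : Prop :=
  (2 < n)%N /\ exists s : 'S_n, G = [set [set s i; s (ordS i)] | i : 'I_n].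

Definition is_two_disjoint_edges (n : nat) (G : {set {set 'I_n}}) : Prop :=
  exists A B : {set 'I_n},
    [/\ #|A| = 2%N, #|B| = 2%N, [disjoint A & B] & G = [set A; B]].

Section GraphIdeals.
Variables (k : fieldType) (n : nat).

Definition Pideal (i j : 'I_n) : {mpoly k[n]} -> Prop :=
  ideal_span (fun p => exists2 t : 'I_n, (t != i) && (t != j) & p = 'X_t).

Definition graph_ideal (G : {set {set 'I_n}}) : {mpoly k[n]} -> Prop :=
  fun p => forall i j : 'I_n, [set i; j] \in G -> Pideal i j p.

Definition graph_symbolic_power (G : {set {set 'I_n}}) (m : nat) :
    {mpoly k[n]} -> Prop :=
  fun p => forall i j : 'I_n, [set i; j] \in G -> ideal_pow (Pideal i j) m p.

End GraphIdeals.

Arguments Pideal k {n} i j _.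
Arguments graph_ideal k {n} G _.
Arguments graph_symbolic_power k {n} G m _.

(* Main.v *)
Require Import Defs.
From mathcomp Require Import all_boot all_order all_algebra all_fingroup.
From mathcomp Require Import zify.

Set Implicit Arguments.
Unset Strict Implicit.
Unset Printing Implicit Defensive.

Import GRing.Theory.

(** All ideals involved are monomial, so both powers are governed by exponent
vectors.  A polynomial lies in the m-th power of P_ij exactly when each of its
monomials u has degree at least m in the variables outside {i, j}
([Pideal_pow_order]).  The ideal I_G is the Stanley-Reisner ideal of G seen as
a one-dimensional complex: its monomials are those whose support is a nonface,
a set contained in no edge.

Membership in the ordinary power is obstructed by weights.  If w is a weight on
the vertices for which every nonface weighs at least d, then all monomials of
I_G^m weigh at least m * d.  Hence a set T with |T \ A| >= r for all edges A but
w(T) < r * d yields a monomial of I_G^(r) outside I_G^r; multiplying it by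
powers of the monomial of a nonface of weight d propagates this to every
m >= r ([symbolic_power_neq]).  Three instances suffice.
- A triangle abc and a fourth vertex v: T = {a, b, c, v}, r = 2, weights
  1, 1, 1, 2, and 3 elsewhere, with d = 3, so that w(T) = 5 < 6.
- Three vertices without edges between them: T is this triple, r = 2, weights
  1 on T and 2 elsewhere, with d = 2, so that w(T) = 3 < 4.
- Five vertices, not all joined to each other: T is this quintuple, r = 3, the
  same kind of weights, so that w(T) = 5 < 6.  This is the only instance that
  requires m >= 3.
Therefore equality for some m >= 3 forces n = 4, and G contains neither a
triangle nor an independent triple.

A graph on four vertices of this kind contains disjoint edges ab and cd with ad
and bc not edges ([crossed_exists]), and according to how many of ac and bd are
edges it is two disjoint edges, a path or a cycle.  Conversely, in these graphs
I_G is generated by x_a x_d, x_b x_c and those of x_a x_c, x_b x_d that come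
from nonedges.  Taking the first two generators as often as possible in a
monomial of I_G^(m), and then the third one that still fits, gives m factors
([crossed_packing], [crossed_ideal_eq]). *)

(** * Ideal spans and powers *)

Section Ideals.
Local Open Scope ring_scope.
Variable R : comNzRingType.
Implicit Types I J : R -> Prop.

Lemma ideal_span_gen (A : R -> Prop) r g : A g -> ideal_span A (r * g).
Proof.
move=> Ag; exists [:: (r, g)]; rewrite big_seq1.
by split=> // c /[1!inE] /eqP->.
Qed.

Lemma ideal_span_sum (A : R -> Prop) (T : eqType) (s : seq T) (F : T -> R) :
  (forall x, x \in s -> ideal_span A (F x)) ->
  ideal_span A (\sum_(x <- s) F x).
Proof.
elim: s => [_|x s IHs sA]; first by exists [::]; rewrite !big_nil.
have [|c1 [c1A Ec1]] := sA x; first exact: mem_head.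
have [|c2 [c2A Ec2]] := IHs.
  by move=> y ys; apply: sA; rewrite inE ys orbT.
exists (c1 ++ c2); rewrite big_cons big_cat -Ec1 -Ec2; split=> // c.
by rewrite mem_cat => /orP[/c1A|/c2A].
Qed.

Lemma ideal_span_mul (A : R -> Prop) r p :
  ideal_span A p -> ideal_span A (r * p).
Proof.
case=> s [sA ->]; rewrite mulr_sumr; apply: ideal_span_sum => c /sA Ac.
by rewrite mulrA; apply: ideal_span_gen.
Qed.

Lemma ideal_pow_subset I J m p :
  (forall q, I q -> J q) -> ideal_pow I m p -> ideal_pow J m p.
Proof.
move=> IJ [s [sI ->]]; exists s; split=> // c /sI[f [fI fE]].
by exists f; split=> // i; apply: IJ.
Qed.

(** Allowing more than m factors and an arbitrary cofactor is what makes this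
usable on a monomial divisible by enough generators. *)
Lemma ideal_pow_prod I m (s : seq R) r : (m <= size s)%N ->
  (forall x, x \in s -> I x) -> ideal_pow I m (r * \prod_(x <- s) x).
Proof.
move=> ms sI; rewrite -(cat_take_drop m s) big_cat /= mulrCA mulrC.
apply: ideal_span_gen; exists (fun i : 'I_m => nth 0 s i); split=> [i|].
  by apply/sI/mem_nth/(leq_trans (ltn_ord i)).
rewrite (big_nth 0) size_takel // big_mkord.
by apply: eq_bigr => i _; rewrite nth_take.
Qed.

End Ideals.

(** * Weights of monomials *)

Section Weights.
Variables (k : fieldType) (n : nat).
Implicit Types (w : 'I_n -> nat) (u g : 'X_{1..n}) (p q : {mpoly k[n]}).

Definition wt w u : nat := \sum_(t < n) w t * u t.

Definition order_ge w d p : Prop := {in msupp p, forall u, d <= wt w u}.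

Lemma wtD w u v : wt w (u + v)%MM = wt w u + wt w v.
Proof. by rewrite -big_split; apply: eq_bigr => t _; rewrite mnmDE mulnDr. Qed.

Lemma wtMn w u d : wt w (u *+ d)%MM = wt w u * d.
Proof. by rewrite big_distrl; apply: eq_bigr => t _; rewrite mulmnE mulnA. Qed.

Lemma order_ge_sum w d (T : eqType) (s : seq T) (F : T -> {mpoly k[n]}) :
  (forall x, x \in s -> order_ge w d (F x)) ->
  order_ge w d (\sum_(x <- s) F x)%R.
Proof.
elim: s => [_ u|x s IHs sF u]; first by rewrite big_nil msupp0.
rewrite big_cons => /msuppD_le; rewrite mem_cat => /orP[].
  by apply: sF; apply: mem_head.
by apply: IHs => y ys; apply: sF; rewrite inE ys orbT.
Qed.

Lemma order_ge_mul w d e p q :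
  order_ge w d p -> order_ge w e q -> order_ge w (d + e) (p * q)%R.
Proof.
move=> pd qe u /msuppM_le /allpairsP[[u1 u2] /= [/pd ? /qe ? ->]].
by rewrite wtD leq_add.
Qed.

Lemma order_ge_span w d (A : {mpoly k[n]} -> Prop) p :
  (forall q, A q -> order_ge w d q) -> ideal_span A p -> order_ge w d p.
Proof.
move=> Ad [s [sA ->]]; apply: order_ge_sum => c /sA /Ad cd.
by apply: (@order_ge_mul w 0 d) => // u.
Qed.

(** The only necessary condition for membership in an ordinary power that the
proof uses: weights are additive, so products of m elements weigh m times as
much. *)
Lemma order_ge_pow w d (I : {mpoly k[n]} -> Prop) m p :
  (forall q, I q -> order_ge w d q) -> ideal_pow I m p -> order_ge w (m * d) p.
Proof.
move=> Id; apply: order_ge_span => _ [f [fI ->]].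
elim: m f fI => [f _ u|m IHm f fI]; first by rewrite mul0n.
rewrite big_ord_recl mulSn; apply: order_ge_mul; first exact: Id.
by apply: IHm => i; apply: fI.
Qed.

Lemma ideal_span_monomials (A : {mpoly k[n]} -> Prop) p :
  {in msupp p, forall u, ideal_span A 'X_[u]} -> ideal_span A p.
Proof.
move=> pA; rewrite [p]mpolyE; apply: ideal_span_sum => u /pA Xu.
by rewrite -mul_mpolyC; apply: ideal_span_mul.
Qed.

(** The sufficient condition dual to [order_ge_pow]: membership of a monomial in
a power is certified by packing m monomials of the ideal into it. *)
Lemma ideal_pow_monomial (I : {mpoly k[n]} -> Prop) m u (s : seq 'X_{1..n}) :
  m <= size s -> {in s, forall g, I 'X_[g]} ->
  (forall t, \sum_(g <- s) (g : 'X_{1..n}) t <= u t) -> ideal_pow I m 'X_[u].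
Proof.
move=> ms sI su.
have /submK <- : (\sum_(g <- s) g <= u)%MM.
  by apply/mnm_lepP => t; rewrite mnm_sumE.
rewrite mpolyXD -mpolyX_prod -(big_map (fun g => 'X_[g]) xpredT id).
apply: ideal_pow_prod; first by rewrite size_map.
by move=> _ /mapP[g /sI ? ->].
Qed.

(** As a weight, [off A] counts the degree in the variables outside A, which is
the order along the prime P_ij when A = {i, j}. *)
Definition off (A : {set 'I_n}) (t : 'I_n) : nat := t \notin A.

Lemma Pideal_order i j p : Pideal k i j p -> order_ge (off [set i; j]) 1 p.
Proof.
apply: order_ge_span => _ [t /andP[ti tj] ->] u; rewrite msuppX inE => /eqP->.
by rewrite /wt (bigD1 t) //= mnm1E eqxx muln1 /off !inE negb_or ti tj.
Qed.

Lemma Pideal_monomial i j u t :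
  t \notin [set i; j] -> 0 < u t -> Pideal k i j 'X_[u].
Proof.
rewrite !inE negb_or => tij ut.
have /submK <- : (U_(t) <= u)%MM.
  by apply/mnm_lepP=> t'; rewrite mnm1E; case: eqP => [<-|].
by rewrite mpolyXD; apply: ideal_span_gen; exists t.
Qed.

(** The powers of P_ij are the ideals of the filtration by [off [set i; j]],
because this weight only takes the values 0 and 1 on variables: a monomial of
order m is divisible by m variables of P_ij. *)
Lemma Pideal_pow_order i j m p :
  ideal_pow (Pideal k i j) m p <-> order_ge (off [set i; j]) m p.
Proof.
split=> [|pm].
  by rewrite -{2}[m]muln1; apply: order_ge_pow (@Pideal_order i j).
apply: ideal_span_monomials => u /pm um.
pose s := flatten
  [seq nseq (off [set i; j] t * u t) U_(t)%MM | t <- index_enum 'I_n].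
apply: (@ideal_pow_monomial _ m u s).
- rewrite size_flatten sumnE /shape !big_map; apply: leq_trans um _.
  by apply: leq_sum => t _; rewrite size_nseq.
- move=> g /flatten_mapP[t _ /nseqP[->]]; rewrite /off.
  case: (boolP (t \in _)) => // tij _.
  by apply: (@Pideal_monomial _ _ _ t) => //; rewrite mnm1E eqxx.
move=> t; rewrite big_flatten /= big_map (bigD1 t) //= [X in _ + X]big1 ?addn0.
  rewrite big_nseq iter_addn_0 mnm1E eqxx mul1n /off.
  by case: (t \notin _); rewrite ?mul1n.
by move=> t' t't; rewrite big_nseq iter_addn_0 mnm1E (negPf t't).
Qed.

(** * The graph ideal and its symbolic powers *)

Implicit Types (G : {set {set 'I_n}}) (T U E : {set 'I_n}).

(** The nonfaces are those of the complex whose facets are the edges of G. *)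
Definition nonface G U : Prop :=
  {in G, forall A : {set 'I_n}, ~~ (U \subset A)}.

Definition mset T : 'X_{1..n} := [multinom (t \in T : nat) | t < n].

Lemma wt_mset w T : wt w (mset T) = \sum_(t in T) w t.
Proof.
rewrite big_mkcond; apply: eq_bigr => t _.
by rewrite mnmE; case: (t \in T); rewrite ?muln1 ?muln0.
Qed.

Lemma wt_off_mset A T : wt (off A) (mset T) = #|T :\: A|.
Proof.
rewrite wt_mset -sum1_card [RHS]big_mkcond [LHS]big_mkcond.
by apply: eq_bigr => t _; rewrite inE andbC /off; case: ifP; case: (t \in A).
Qed.

Lemma nonfaceP G U A : nonface G U -> A \in G -> exists2 t, t \in U & t \notin A.
Proof. by move=> GU /GU /subsetPn. Qed.

Lemma graph_ideal_mset G E : nonface G E -> graph_ideal k G 'X_[mset E].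
Proof.
move=> GE i j /(nonfaceP GE)[t tE tij].
by apply: Pideal_monomial tij _; rewrite mnmE tE.
Qed.

(** The support of every monomial of I_G is a nonface, so a bound on the weight
of nonfaces bounds the weight of I_G. *)
Lemma graph_ideal_order G w d p : simple_graph G ->
  (forall U, nonface G U -> d <= \sum_(t in U) w t) ->
  graph_ideal k G p -> order_ge w d p.
Proof.
move=> [G2 _] Gd pG u up; pose U := [set t | 0 < u t].
apply: leq_trans (Gd U _) _ => [A AG|].
  have /eqP/cards2P[i [j [_ EA]]] := G2 A AG; rewrite EA in AG *.
  have := Pideal_order (pG i j AG) up; apply: contraTN => /subsetP sUA.
  rewrite -leqNgt leqn0 sum_nat_eq0; apply/forallP=> t; rewrite /= /off.
  case: (posnP (u t)) => [->|ut]; first by rewrite muln0.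
  by rewrite sUA // inE.
rewrite /wt [leqLHS]big_mkcond; apply: leq_sum => t _; rewrite inE.
by case: ifP => // ut; rewrite leq_pmulr.
Qed.

Lemma ideal_pow_graph_ideal_symbolic G m p :
  ideal_pow (graph_ideal k G) m p -> graph_symbolic_power k G m p.
Proof. by move=> pG i j ij; apply: ideal_pow_subset pG => q; apply. Qed.

(** The monomial x^T lies in the r-th symbolic power but weighs too little for
the r-th ordinary power.  The factor x^E raised to m - r contributes at least
m - r to the order along each edge, since E is a nonface, and at most
(m - r) * d to the weight, so the obstruction survives for all m >= r. *)
Lemma symbolic_power_neq G T E w d r m : simple_graph G -> r <= m ->
  {in G, forall A : {set 'I_n}, r <= #|T :\: A|} ->
  nonface G E ->
  (forall U, nonface G U -> d <= \sum_(t in U) w t) ->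
  \sum_(t in E) w t <= d -> \sum_(t in T) w t < r * d ->
  ~ ideal_eq (graph_symbolic_power k G m) (ideal_pow (graph_ideal k G) m).
Proof.
move=> sG rm GT GE Gw wE wT eqI.
pose u := (mset T + mset E *+ (m - r))%MM.
have /eqI/(order_ge_pow (fun q => graph_ideal_order sG Gw)) :
    graph_symbolic_power k G m 'X_[u].
  move=> i j ij; apply/Pideal_pow_order => v; rewrite msuppX inE => /eqP->.
  rewrite wtD wtMn !wt_off_mset.
  have [t tE tij] := nonfaceP GE ij.
  have E1 : 0 < #|E :\: [set i; j]|.
    by apply/card_gt0P; exists t; rewrite inE tij.
  by have := GT _ ij; nia.
move/(_ u); rewrite msuppX mem_head wtD wtMn !wt_mset => /(_ isT).
by nia.
Qed.

End Weights.

(** * Subgraphs that separate the two powers *)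

Section Obstructions.
Variables (k : fieldType) (n : nat) (G : {set {set 'I_n}}).
Hypothesis simpleG : simple_graph G.
Implicit Types (T U A : {set 'I_n}) (w : 'I_n -> nat).

Lemma edge_neq x y : [set x; y] \in G -> x != y.
Proof. by case: simpleG => G2 _ /G2; rewrite cards2; case: (x == y). Qed.

(** This is where the absence of isolated vertices matters: x lies in an edge,
and a nonface must leave that edge, so it is never contained in {x}. *)
Lemma nonface_other U x : nonface G U -> exists2 t, t \in U & t != x.
Proof.
move=> GU; have : x \in cover G by rewrite (proj2 simpleG) inE.
case/bigcupP=> A AG xA; have [t tU tA] := nonfaceP GU AG.
by exists t => //; apply: contraNneq tA => ->.
Qed.

Lemma nonedge_nonface x y :
  x != y -> [set x; y] \notin G -> nonface G [set x; y].
Proof.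
move=> xy xyG A AG; apply: contra xyG => xyA.
have /eqP-> // : [set x; y] == A.
by rewrite eqEcard xyA cards2 xy (proj1 simpleG A AG).
Qed.

Lemma leq_sum_subset w U (s : seq 'I_n) :
  uniq s -> {subset s <= U} -> \sum_(t <- s) w t <= \sum_(t in U) w t.
Proof.
move=> s_uniq sU; rewrite big_uniq //= [leqLHS]big_mkcond [leqRHS]big_mkcond.
by apply: leq_sum => t _; case: ifP => // /sU ->.
Qed.

Lemma card_set_seq (s : seq 'I_n) : uniq s -> #|[set t in s]| = size s.
Proof. by move=> /card_uniqP <-; rewrite cardsE. Qed.

(** One weight serves for every way of joining the fourth vertex d to the
triangle: 1 on a, b, c, 2 on d and 3 elsewhere.  A nonface of weight less than 3
would be contained in {a, b, c} or equal to {d}; but the only nonface inside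
the triangle is the triangle itself, of weight 3, and no singleton is a
nonface.  The four vertices weigh 5, less than 2 * 3. *)
Lemma triangle_symbolic_neq a b c m : 4 <= n -> 2 <= m ->
  [set a; b] \in G -> [set b; c] \in G -> [set a; c] \in G ->
  ~ ideal_eq (graph_symbolic_power k G m) (ideal_pow (graph_ideal k G) m).
Proof.
move=> n4 m2 ab bc ac.
have abc_uniq : uniq [:: a; b; c] by rewrite /= !inE negb_or !edge_neq.
have [d dabc] : exists d, d \notin [:: a; b; c].
  have: 0 < #|~: [set t in [:: a; b; c]]|.
    have := cardsC [set t in [:: a; b; c]].
    rewrite card_ord (card_set_seq abc_uniq) /=; lia.
  by case/card_gt0P=> d; rewrite inE in_set; exists d.
pose w t := if t \in [:: a; b; c] then 1 else if t == d then 2 else 3.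
have abcd_uniq : uniq [:: d; a; b; c] by rewrite cons_uniq dabc abc_uniq.
have wabc t : t \in [:: a; b; c] -> w t = 1 by rewrite /w => ->.
have wd : w d = 2 by rewrite /w (negPf dabc) eqxx.
have w_gt0 t : 0 < w t by rewrite /w; do 2?case: ifP.
apply: (@symbolic_power_neq _ _ _ [set t in [:: d; a; b; c]]
          [set t in [:: a; b; c]] w 3 2) => // [A AG|A AG|U GU||].
- rewrite -(leq_add2l #|[set t in [:: d; a; b; c]] :&: A|) cardsID.
  rewrite (card_set_seq abcd_uniq) /= -[4]/(2 + 2) leq_add2r.
  by rewrite -(proj1 simpleG A AG) subset_leq_card ?subsetIr.
- apply/negP=> /subset_leq_card.
  by rewrite (card_set_seq abc_uniq) (proj1 simpleG A AG).
- case: (boolP (d \in U)) => [dU|dU].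
    have [t tU td] := nonface_other d GU.
    apply: leq_trans (leq_sum_subset w (s := [:: d; t]) _ _).
    + by rewrite 2!big_cons big_nil wd addn0 (@leq_add 2 1).
    + by rewrite /= inE eq_sym td.
    by apply/allP; rewrite /= dU tU.
  have [|/subsetPn] := boolP (U \subset [:: a; b; c]); last first.
    move=> [t tU tabc].
    apply: leq_trans (leq_sum_subset w (s := [:: t]) _ _) => //.
    + rewrite big_seq1 /w (negPf tabc); case: eqP => // td.
      by rewrite td (negPf dU) in tU.
    by move=> x /[1!inE] /eqP->.
  move=> /subsetP Uabc.
  apply: leq_trans (leq_sum_subset w (s := [:: a; b; c]) _ _) => //.
    by rewrite !big_cons big_nil !wabc ?inE ?eqxx ?orbT.
  apply/allP; rewrite /= andbT; apply/and3P; split.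
  + have [t /[dup] tU /Uabc] := nonfaceP GU bc; rewrite !inE.
    by case/or3P=> /eqP <- ; rewrite ?eqxx ?orbT // tU.
  + have [t /[dup] tU /Uabc] := nonfaceP GU ac; rewrite !inE.
    by case/or3P=> /eqP <- ; rewrite ?eqxx ?orbT // tU.
  have [t /[dup] tU /Uabc] := nonfaceP GU ab; rewrite !inE.
  by case/or3P=> /eqP <- ; rewrite ?eqxx ?orbT // tU.
- rewrite (eq_bigl (mem [:: a; b; c])) => [|t]; last by rewrite inE.
  by rewrite -big_uniq //= !big_cons big_nil !wabc ?inE ?eqxx ?orbT.
rewrite (eq_bigl (mem [:: d; a; b; c])) => [|t]; last by rewrite inE.
by rewrite -big_uniq //= !big_cons big_nil wd !wabc ?inE ?eqxx ?orbT.
Qed.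

(** The odd-cycle obstruction for edge ideals: a set T of fewer than 2r vertices
cannot contain r disjoint nonfaces, although its order along every edge is at
least r. *)
Lemma odd_set_symbolic_neq T r x y m : r <= m -> #|T| < r.*2 ->
  {in G, forall A : {set 'I_n}, r <= #|T :\: A|} ->
  x \in T -> y \in T -> x != y -> [set x; y] \notin G ->
  ~ ideal_eq (graph_symbolic_power k G m) (ideal_pow (graph_ideal k G) m).
Proof.
move=> rm Tr GT xT yT xy xyG.
(* A nonface has at least two vertices, hence weight at least 2. *)
pose w t := if t \in T then 1 else 2.
have w_gt0 t : 0 < w t by rewrite /w; case: ifP.
apply: (@symbolic_power_neq _ _ _ T [set x; y] w 2 r) => // [|U GU||].
- exact: nonedge_nonface.
- have [t tU _] := nonface_other x GU; have [t' t'U t't] := nonface_other t GU.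
  apply: leq_trans (leq_sum_subset w (s := [:: t; t']) _ _).
  + by rewrite 2!big_cons big_nil addn0 (@leq_add 1 1).
  + by rewrite /= inE eq_sym t't.
  by apply/allP; rewrite /= tU t'U.
- by rewrite big_setU1 ?inE //= big_set1 /w xT yT.
rewrite muln2; apply: leq_ltn_trans Tr; rewrite -sum1_card.
by apply: leq_sum => t; rewrite /w => ->.
Qed.

Lemma independent_triple_symbolic_neq a b c m : 2 <= m -> uniq [:: a; b; c] ->
  [set a; b] \notin G -> [set b; c] \notin G -> [set a; c] \notin G ->
  ~ ideal_eq (graph_symbolic_power k G m) (ideal_pow (graph_ideal k G) m).
Proof.
move=> m2 abc_uniq ab bc ac.
apply: (@odd_set_symbolic_neq [set t in [:: a; b; c]] 2 a b) => //.
- by rewrite (card_set_seq abc_uniq).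
- move=> A AG; set T := [set t in _].
  have T3 : #|T| = 3 by rewrite card_set_seq.
  suff : #|T :&: A| < 2 by have := cardsID A T; lia.
  rewrite ltnNge; apply/negP=> leI.
  have /eqP/setIidPr/subsetP sA : T :&: A == A.
    by rewrite eqEcard subsetIr (proj1 simpleG A AG).
  have /eqP/cards2P[x [y [xy EA]]] := proj1 simpleG A AG.
  have := sA x; have := sA y; rewrite EA !inE !eqxx orbT => /(_ isT) + /(_ isT).
  case/or3P=> /eqP yE /or3P[] /eqP xE; move: AG xy; rewrite EA xE yE ?eqxx //.
  + by rewrite setUC (negPf ab).
  + by rewrite setUC (negPf ac).
  + by rewrite (negPf ab).
  + by rewrite setUC (negPf bc).
  + by rewrite (negPf ac).
  by rewrite (negPf bc).
- by rewrite !inE eqxx.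
- by rewrite !inE eqxx orbT.
by move: abc_uniq; rewrite /= !inE negb_or => /andP[/andP[]].
Qed.

(** Any five vertices T satisfy |T \ A| >= 3 for all edges A.  If two of three
chosen vertices of T are not joined, this nonedge makes T an odd-set
obstruction; otherwise the three form a triangle. *)
Lemma five_points_symbolic_neq m : 5 <= n -> 3 <= m ->
  ~ ideal_eq (graph_symbolic_power k G m) (ideal_pow (graph_ideal k G) m).
Proof.
move=> n5 m3.
have /card_geqP[s [s_uniq s5 _]] : 5 <= #|[set: 'I_n]|.
  by rewrite cardsT card_ord.
case: s s5 s_uniq => [|a [|b [|c s]]] // [s2] s_uniq.
have abc_uniq : uniq [:: a; b; c].
  by apply: (subseq_uniq _ s_uniq); apply: (@prefix_subseq _ [:: a; b; c]).
have five := odd_set_symbolic_neq (T := [set t in a :: b :: c :: s]) m3.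
have {five} five x y : x \in [:: a; b; c] -> y \in [:: a; b; c] -> x != y ->
    [set x; y] \notin G ->
    ~ ideal_eq (graph_symbolic_power k G m) (ideal_pow (graph_ideal k G) m).
  have sT z : z \in [:: a; b; c] -> z \in [set t in a :: b :: c :: s].
    by rewrite in_set !inE => /or3P[] ->; rewrite ?orbT.
  move=> /sT xT /sT yT; apply: five xT yT.
    by rewrite (card_set_seq s_uniq) /= s2.
  move=> A AG; set T := [set t in _].
  have T5 : #|T| = 5 by rewrite card_set_seq //= s2.
  have := cardsID A T; have := subset_leq_card (subsetIr T A).
  by rewrite (proj1 simpleG A AG); lia.
move: abc_uniq; rewrite /= !inE negb_or => /andP[/andP[ab ac] /andP[bc _]].
have [abG|] := boolP ([set a; b] \in G); last first.
  by apply: five ab; rewrite !inE eqxx ?orbT.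
have [bcG|] := boolP ([set b; c] \in G); last first.
  by apply: five bc; rewrite !inE eqxx ?orbT.
have [acG|] := boolP ([set a; c] \in G); last first.
  by apply: five ac; rewrite !inE eqxx ?orbT.
by apply: triangle_symbolic_neq abG bcG acG; lia.
Qed.

End Obstructions.

(** * Graphs on four vertices *)

Section FourVertices.

(** The pairs ac and bd are left free.  On four vertices this is the common
shape of the three kinds of graphs: with none, one or both of ac and bd as an
edge, G is two disjoint edges, a path or a cycle. *)
Definition crossed n (G : {set {set 'I_n}}) (a b c d : 'I_n) : bool :=
  [&& [set a; b] \in G, [set c; d] \in G, [set a; d] \notin G
    & [set b; c] \notin G].

(** By inspection of the 64 graphs on a, b, c, d.  Three perfect matchings can
play the role of ab and cd, each with two choices of the opposite pairs ad and bc,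
which gives the six arrangements. *)
Lemma crossed_exists n (G : {set {set 'I_n}}) (a b c d : 'I_n) :
  uniq [:: a; b; c; d] ->
  (forall x y z, uniq [:: x; y; z] ->
     ~~ [&& [set x; y] \in G, [set y; z] \in G & [set x; z] \in G]) ->
  (forall x y z, uniq [:: x; y; z] ->
     [|| [set x; y] \in G, [set y; z] \in G | [set x; z] \in G]) ->
  exists x y z t, uniq [:: x; y; z; t] /\ crossed G x y z t.
Proof.
move=> abcd noT noI.
have perm s : perm_eq s [:: a; b; c; d] -> uniq s by move/perm_uniq ->.
suff : [|| crossed G a b c d, crossed G a b d c, crossed G a c b d,
           crossed G a c d b, crossed G a d b c | crossed G a d c b].
  case/orP=> [?|]; first by exists a, b, c, d.
  case/orP=> [?|]; last case/orP=> [?|]; last case/orP=> [?|];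
    last case/orP=> [?|?];
    [exists a, b, d, c|exists a, c, b, d|exists a, c, d, b|exists a, d, b, c
    |exists a, d, c, b]; split=> //; apply: perm; apply/seq.permP=> P /=; lia.
rewrite /crossed [[set c; b]]setUC [[set d; b]]setUC [[set d; c]]setUC.
have s1 : uniq [:: a; b; c] := mask_uniq abcd [:: true; true; true; false].
have s2 : uniq [:: a; b; d] := mask_uniq abcd [:: true; true; false; true].
have s3 : uniq [:: a; c; d] := mask_uniq abcd [:: true; false; true; true].
have s4 : uniq [:: b; c; d] := mask_uniq abcd [:: false; true; true; true].
move: (noT _ _ _ s1) (noT _ _ _ s2) (noT _ _ _ s3) (noT _ _ _ s4).
move: (noI _ _ _ s1) (noI _ _ _ s2) (noI _ _ _ s3) (noI _ _ _ s4).
by case: (_ \in G); case: (_ \in G); case: (_ \in G); case: (_ \in G);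
  case: (_ \in G); case: (_ \in G).
Qed.

Lemma eq_set2 (T : finType) (x y z t : T) :
  ([set x; y] == [set z; t]) = (x == z) && (y == t) || (x == t) && (y == z).
Proof.
apply/eqP/idP => [E|/orP[]/andP[/eqP-> /eqP->] //]; last by rewrite setUC.
have := set21 x y; have := set22 x y; rewrite {1 2}E.
have := set21 z t; have := set22 z t; rewrite -{1 2}E !inE.
rewrite ![z == x]eq_sym ![z == y]eq_sym ![t == x]eq_sym ![t == y]eq_sym.
by do 4!case: (_ == _).
Qed.

Lemma uniq4_mem (a b c d x : 'I_4) :
  uniq [:: a; b; c; d] -> x \in [:: a; b; c; d].
Proof.
move=> abcd; have : x \in [set t in [:: a; b; c; d]]; last by rewrite inE.
have /eqP-> : [set t in [:: a; b; c; d]] == setT; last by rewrite inE.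
by rewrite eqEcard subsetT cardsT card_ord card_set_seq.
Qed.

Lemma uniq4_big (a b c d : 'I_4) (F : 'I_4 -> nat) : uniq [:: a; b; c; d] ->
  \sum_t F t = F a + F b + F c + F d.
Proof.
move=> abcd; transitivity (\sum_(t <- [:: a; b; c; d]) F t).
  by rewrite [RHS]big_uniq //; apply: eq_bigl => t; rewrite uniq4_mem.
by rewrite !big_cons big_nil addn0 !addnA.
Qed.

Variable G : {set {set 'I_4}}.
Hypothesis simpleG : simple_graph G.

Lemma crossed_edges a b c d : uniq [:: a; b; c; d] -> crossed G a b c d ->
  G = [set [set a; b]; [set c; d]]
      :|: (if [set a; c] \in G then [set [set a; c]] else set0)
      :|: (if [set b; d] \in G then [set [set b; d]] else set0).
Proof.
move=> abcd /and4P[ab cd ad bc]; apply/setP=> A; rewrite !inE.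
apply/idP/idP => [AG|]; last first.
  by case/orP=> [/orP[/orP[]/eqP->//|]|]; case: ifP => ?;
    rewrite ?inE // => /eqP->.
have /eqP/cards2P[x [y [xy EA]]] := proj1 simpleG A AG; move: AG; rewrite EA.
have := uniq4_mem x abcd; have := uniq4_mem y abcd; rewrite !inE.
case/or4P=> /eqP yE /or4P[]/eqP xE; move: xy; rewrite xE yE ?eqxx // => _.
(* Orient every pair in the order a, b, c, d. *)
all: rewrite 1?[[set b; a]]setUC 1?[[set c; a]]setUC 1?[[set d; a]]setUC.
all: rewrite 1?[[set c; b]]setUC 1?[[set d; b]]setUC 1?[[set d; c]]setUC.
all: rewrite ?(negPf ad) ?(negPf bc) //.
all: by move=> xyG; rewrite ?xyG ?inE ?eqxx ?orbT.
Qed.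

Definition o0 : 'I_4 := @Ordinal 4 0 isT.
Definition o1 : 'I_4 := @Ordinal 4 1 isT.
Definition o2 : 'I_4 := @Ordinal 4 2 isT.
Definition o3 : 'I_4 := @Ordinal 4 3 isT.

Lemma path4E (s : 'S_4) :
  [set [set s i; s j] | i in 'I_4, j in 'I_4 & j == i.+1 :> nat] =
  [set [set s o0; s o1]; [set s o1; s o2]; [set s o2; s o3]].
Proof.
apply/setP=> A; rewrite !inE; apply/imset2P/idP => [[i j _]|].
  rewrite inE => /andP[_ /eqP ij] ->.
  case: i j ij => [[|[|[|[|?]]]] // i4] [j j4] /= ij; subst j => //.
  - apply/orP; left; apply/orP; left; apply/eqP.
    by congr [set s _; s _]; apply/val_inj.
  - apply/orP; left; apply/orP; right; apply/eqP.
    by congr [set s _; s _]; apply/val_inj.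
  by apply/orP; right; apply/eqP; congr [set s _; s _]; apply/val_inj.
by case/orP=> [/orP[]|] /eqP->; [exists o0 o1|exists o1 o2|exists o2 o3];
  rewrite ?inE.
Qed.

Lemma cycle4E (s : 'S_4) :
  [set [set s i; s (ordS i)] | i : 'I_4] =
  [set [set s o0; s o1]; [set s o1; s o2]; [set s o2; s o3]; [set s o3; s o0]].
Proof.
have S0 : ordS o0 = o1 by apply/val_inj.
have S1 : ordS o1 = o2 by apply/val_inj.
have S2 : ordS o2 = o3 by apply/val_inj.
have S3 : ordS o3 = o0 by apply/val_inj.
apply/setP=> A; rewrite !inE; apply/imsetP/idP => [[i _ ->]|].
  have : uniq [:: o0; o1; o2; o3] by [].
  by move/(uniq4_mem i); rewrite !inE => /or4P[]/eqP->;
    rewrite ?S0 ?S1 ?S2 ?S3 eqxx ?orbT.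
by case/orP=> [/orP[/orP[]|]|] /eqP->; [exists o0|exists o1|exists o2|exists o3];
  rewrite ?S0 ?S1 ?S2 ?S3 ?inE.
Qed.

Lemma perm_of_uniq4 (a b c d : 'I_4) : uniq [:: a; b; c; d] ->
  exists s : 'S_4, [/\ s o0 = a, s o1 = b, s o2 = c & s o3 = d].
Proof.
move=> abcd; pose f (i : 'I_4) := tnth [tuple a; b; c; d] i.
have f_inj : injective f by apply/tuple_uniqP.
by exists (perm f_inj); rewrite !permE /f !(tnth_nth a).
Qed.

Lemma crossed_path_cycle_edges a b c d :
  uniq [:: a; b; c; d] -> crossed G a b c d ->
  is_path_graph G \/ is_cycle_graph G \/ is_two_disjoint_edges G.
Proof.
move=> abcd Gx; have := crossed_edges abcd Gx.
have [acG|acG] := boolP ([set a; c] \in G);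
  have [bdG|bdG] := boolP ([set b; d] \in G) => EG.
- right; left; split=> //.
  have [|s [s0 s1 s2 s3]] := @perm_of_uniq4 b a c d.
    rewrite -(perm_uniq (s1 := [:: a; b; c; d])) //.
    by apply/seq.permP=> P /=; lia.
  exists s; rewrite cycle4E s0 s1 s2 s3 EG; apply/setP=> A; rewrite !inE.
  rewrite [[set b; a]]setUC [[set d; b]]setUC.
  by do 4!case: (A == _).
- left; have [|s [s0 s1 s2 s3]] := @perm_of_uniq4 b a c d.
    rewrite -(perm_uniq (s1 := [:: a; b; c; d])) //.
    by apply/seq.permP=> P /=; lia.
  exists s; rewrite path4E s0 s1 s2 s3 EG; apply/setP=> A; rewrite !inE.
  rewrite [[set b; a]]setUC.
  by do 3!case: (A == _).
- left; have [|s [s0 s1 s2 s3]] := @perm_of_uniq4 a b d c.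
    rewrite -(perm_uniq (s1 := [:: a; b; c; d])) //.
    by apply/seq.permP=> P /=; lia.
  exists s; rewrite path4E s0 s1 s2 s3 EG; apply/setP=> A; rewrite !inE.
  rewrite [[set d; c]]setUC.
  by do 3!case: (A == _).
right; right; exists [set a; b], [set c; d]; rewrite !setU0 in EG.
have := abcd; rewrite /= !inE !negb_or.
case/and4P=> [/and3P[ab ac ad] /andP[bc bd] cd _].
split=> //; rewrite ?cards2 ?ab ?cd //.
apply/pred0P=> x /=; rewrite !inE; apply/negP=> /andP[/orP[]/eqP->].
  by rewrite (negPf ac) (negPf ad).
by rewrite (negPf bc) (negPf bd).
Qed.

Lemma path_cycle_edges_crossed :
  is_path_graph G \/ is_cycle_graph G \/ is_two_disjoint_edges G ->
  exists a b c d, uniq [:: a; b; c; d] /\ crossed G a b c d.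
Proof.
have s_inj (s : 'S_4) := inj_eq (@perm_inj _ s).
case=> [[s]|[[_ [s]]|[A [B [A2 B2 AB]]]]].
- rewrite path4E => ->; exists (s o1), (s o0), (s o2), (s o3).
  by rewrite /crossed /= !inE !eq_set2 !s_inj.
- rewrite cycle4E => ->; exists (s o0), (s o1), (s o3), (s o2).
  by rewrite /crossed /= !inE !eq_set2 !s_inj.
move/eqP: A2 AB => /cards2P[a [b [ab ->]]].
move/eqP: B2 => /cards2P[c [d [cd ->]]] /pred0P AB ->.
move: (AB c) (AB d) => /=; rewrite !inE !eqxx /= !orbT !andbT.
move=> /norP[ca cb] /norP[da db].
exists a, b, c, d; rewrite /crossed /= !inE !eq_set2 !eqxx /= !orbT /=.
rewrite (negPf ab) (negPf cd) ![b == _]eq_sym ![a == _]eq_sym.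
rewrite (negPf ca) (negPf da) (negPf cb) (negPf db).
by rewrite !andbF.
Qed.

(** Reversing the order of the four vertices allows the exponents of x_a and x_d
to be assumed ordered in either way. *)
Lemma crossed_sym a b c d : crossed G a b c d -> crossed G d c b a.
Proof.
by case/and4P=> ab cd ad bc; rewrite /crossed ![[set d; _]]setUC [[set b; a]]setUC
  [[set c; b]]setUC ab cd ad.
Qed.

Lemma off4 (a b c d : 'I_4) u : uniq [:: a; b; c; d] ->
  wt (off [set c; d]) u = u a + u b.
Proof.
move=> abcd; rewrite /wt (uniq4_big _ abcd) /off !inE !eqxx !orbT.
move: abcd; rewrite /= !inE !negb_or => /and4P[/and3P[_ ac ad] /andP[bc bd] _ _].
by rewrite (negPf ac) (negPf ad) (negPf bc) (negPf bd) /= !mul1n !addn0.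
Qed.

(** With a, b, c, d the exponents of x_a, x_b, x_c, x_d, this counts a copies of
x_a x_d, minn b c copies of x_b x_c, and as many copies of x_b x_d as still fit
when bd is not an edge.  If bd is an edge, the condition m <= a + c along it
replaces these last factors. *)
Lemma crossed_packing (a b c d m : nat) (bd : bool) :
  a <= d -> m <= a + b -> m <= c + d -> (bd -> m <= a + c) ->
  m <= a + minn b c + (if bd then 0 else minn (b - c) (d - a)).
Proof. by case: bd => ? ? ? H; [move: (H isT)|]; lia. Qed.

Lemma crossed_monomial (k : fieldType) a b c d m u :
  uniq [:: a; b; c; d] -> crossed G a b c d ->
  (forall x y, [set x; y] \in G -> m <= wt (off [set x; y]) u) ->
  u a <= u d -> ideal_pow (graph_ideal k G) m 'X_[u].
Proof.
move=> abcd /and4P[abG cdG adG bcG] um ad_le.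
have := um _ _ cdG; rewrite (off4 _ abcd) => m_ab.
have cdab : uniq [:: c; d; a; b].
  by rewrite -(perm_uniq (s1 := [:: a; b; c; d])) //; apply/seq.permP=> P /=; lia.
have acbd : uniq [:: a; c; b; d].
  by rewrite -(perm_uniq (s1 := [:: a; b; c; d])) //; apply/seq.permP=> P /=; lia.
have := um _ _ abG; rewrite (off4 _ cdab) => m_cd.
have m_ac : [set b; d] \in G -> m <= u a + u c.
  by move/um; rewrite (off4 _ acbd).
have := crossed_packing ad_le m_ab m_cd m_ac.
set z := if _ then _ else _ => m_le.
have := abcd; rewrite /= !inE !negb_or.
case/and4P=> [/and3P[ab ac ad] /andP[bc bd] cd _].
apply: (@ideal_pow_monomial _ _ _ m u (nseq (u a) (mset [set a; d]) ++
   nseq (minn (u b) (u c)) (mset [set b; c]) ++ nseq z (mset [set b; d]))).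
- by rewrite !size_cat !size_nseq addnA.
- move=> g; rewrite !mem_cat => /or3P[]/nseqP[-> z_gt0];
    apply/graph_ideal_mset/nonedge_nonface => //.
  by move: z_gt0; rewrite /z; case: ifP.
have z_b : z <= u b - u c by rewrite /z; case: ifP => // _; apply: geq_minl.
have z_d : z <= u d - u a by rewrite /z; case: ifP => // _; apply: geq_minr.
move=> t; rewrite !big_cat /= !big_nseq !iter_addn_0 !mnmE.
have neq := (negPf ab, negPf ac, negPf ad, negPf bc, negPf bd, negPf cd).
have qen :=
  (eq_sym b a, eq_sym c a, eq_sym d a, eq_sym c b, eq_sym d b, eq_sym d c).
move: m_ab m_cd m_le z_b z_d ad_le; have := uniq4_mem t abcd; rewrite !inE.
clear -neq qen.
case/or4P=> /eqP->; rewrite !eqxx ?qen ?neq /=; lia.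
Qed.

Lemma crossed_ideal_eq (k : fieldType) a b c d m :
  uniq [:: a; b; c; d] -> crossed G a b c d ->
  ideal_eq (graph_symbolic_power k G m) (ideal_pow (graph_ideal k G) m).
Proof.
move=> abcd Gx p; split=> [pm|]; last exact: ideal_pow_graph_ideal_symbolic.
apply: ideal_span_monomials => u up.
have um x y : [set x; y] \in G -> m <= wt (off [set x; y]) u.
  by move=> /pm/Pideal_pow_order; apply.
have [|/ltnW da_le] := leqP (u a) (u d).
  exact: crossed_monomial abcd Gx um.
apply: crossed_monomial (crossed_sym Gx) um da_le.
by rewrite -[_ :: _]/(rev [:: a; b; c; d]) rev_uniq.
Qed.

End FourVertices.

Theorem theorem3p3 (k : fieldType) (n : nat) (hn : 4 <= n)
    (G : {set {set 'I_n}}) (hG : simple_graph G) (m : nat) (hm : 3 <= m) :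
  ideal_eq (graph_symbolic_power k G m) (ideal_pow (graph_ideal k G) m) <->
  n = 4 /\ (is_path_graph G \/ is_cycle_graph G \/ is_two_disjoint_edges G).
Proof.
split=> [eqI|[n4 GT]]; last first.
  subst n; have [a [b [c [d [abcd Gx]]]]] := path_cycle_edges_crossed GT.
  exact: crossed_ideal_eq abcd Gx.
have n4 : n = 4.
  apply/eqP; rewrite eqn_leq hn andbT leqNgt; apply/negP=> n5.
  exact: five_points_symbolic_neq eqI.
split=> //; subst n.
have [|||a [b [c [d [abcd Gx]]]]] := @crossed_exists 4 G o0 o1 o2 o3 => //.
- move=> x y z _; apply/negP=> /and3P[xy yz xz].
  by apply: triangle_symbolic_neq xy yz xz eqI => //; apply: ltnW.
- move=> x y z xyz; apply/negPn/negP; rewrite !negb_or => /and3P[xy yz xz].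
  by apply: independent_triple_symbolic_neq xyz xy yz xz eqI => //; apply: ltnW.
exact: crossed_path_cycle_edges abcd Gx.
Qed.
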